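(* Assume Markov induction. Let $\chi:A\to\nabla_0B$ be an oracle, $P:\mathbb{N}\to\mathcal{U}$ a family of types, and $f:\prod_{n:\mathbb{N}}\bigcirc_\chi(P(n)+\neg P(n))$. Then $\neg\neg\,\bigcirc_\chi\left(\sum_{n:\mathbb{N}}P(n)\right)\to\bigcirc_\chi\left(\sum_{n:\mathbb{N}}P(n)\right)$.
   Context: Setting: homotopy type theory with a univalent universe $\mathcal{U}$ of small types and higher inductive types. It is assumed that there is a small type $\Omega_{\neg\neg}:\mathcal{U}$ classifying $\neg\neg$-stable propositions. For a type $X$, $\nabla_0X$ is the type of $\xi:X\to\Omega_{\neg\neg}$ such that $\neg\neg\sum_{x:X}\xi(x)$ and $\prod_{x,y:X}\xi(x)\to\xi(y)\to\neg\neg(x=y)$; write $\xi\downarrow:=\sum_{x:X}\xi(x)$ and $\xi\downarrow=x$ for $\xi(x)$. The nullification at a family $B:A\to\mathcal{U}$ is the higher modality whose modal types are exactly the $X$ with every constant map $X\to X^{B(a)}$ an equivalence. An oracle is a map $\chi:A\to\nabla_0B$; the oracle modality $\bigcirc_\chi$ is the nullification at $a\mapsto\chi(a)\downarrow$. Markov induction (MI): write $\mathtt{IsSuc}(\mu,\nu):=\prod_{m:\mathbb{N}}(\mu\downarrow=m)\to(\nu\downarrow=m+1)$ for $\mu,\nu:\nabla_0\mathbb{N}$; MI asserts that for every $P:\nabla_0\mathbb{N}\to\mathcal{U}$ and every $h:\prod_{\nu:\nabla_0\mathbb{N}}\left(\prod_{\mu:\nabla_0\mathbb{N}}\mathtt{IsSuc}(\mu,\nu)\to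 P(\mu)\right)\to P(\nu)$ there is a section $\prod_{\nu:\nabla_0\mathbb{N}}P(\nu)$. *)

(* Defs.v *)
Definition isEquiv {X Y : Type} (f : X -> Y) : Type :=
  ({g : Y -> X & forall y, f (g y) = y} * {h : Y -> X & forall x, h (f x) = x})%type.

Definition OmegaNN : Type := {P : Prop | ~ ~ P -> P}.

Definition holds (p : OmegaNN) : Prop := proj1_sig p.

Definition nabla0 (X : Type) : Type :=
  {xi : X -> OmegaNN &
     ((({x : X & holds (xi x)} -> False) -> False) *
      (forall x y : X, holds (xi x) -> holds (xi y) -> ~ ~ (x = y)))%type}.

Definition downEq {X : Type} (xi : nabla0 X) (x : X) : Prop :=
  holds (projT1 xi x).

Definition down {X : Type} (xi : nabla0 X) : Type :=
  {x : X & downEq xi x}.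

Definition isNull {A : Type} (B : A -> Type) (X : Type) : Type :=
  forall a : A, isEquiv (fun (x : X) (_ : B a) => x).

(* Any structure satisfying these rules is
   equivalent to the HIT nullification, so quantifying over all of them
   is the same as speaking of "the" nullification. *)
Record Nullification {A : Type} (B : A -> Type) : Type := {
  nO : Type -> Type;
  nEta : forall X : Type, X -> nO X;
  nO_null : forall X : Type, isNull B (nO X);
  nInd : forall (X : Type) (Q : nO X -> Type),
           (forall z, isNull B (Q z)) ->
           (forall x : X, Q (nEta X x)) -> forall z : nO X, Q z;
  nInd_beta : forall (X : Type) (Q : nO X -> Type)
           (HQ : forall z, isNull B (Q z)) (g : forall x : X, Q (nEta X x))
           (x : X), nInd X Q HQ g (nEta X x) = g x
}.

Arguments nO {A B} _ _.
Arguments nEta {A B} _ {X} _.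

Definition OracleModality {A B : Type} (chi : A -> nabla0 B) : Type :=
  Nullification (fun a : A => down (chi a)).

Definition IsSuc (mu nu : nabla0 nat) : Prop :=
  forall m : nat, downEq mu m -> downEq nu (S m).

Definition MarkovInduction : Type :=
  forall (P : nabla0 nat -> Type),
    (forall nu : nabla0 nat,
        (forall mu : nabla0 nat, IsSuc mu nu -> P mu) -> P nu) ->
    forall nu : nabla0 nat, P nu.

(* Main.v *)
(* Markov induction runs over the ¬¬-points ν of ℕ that locate the first witness of
   [P] at or after the current index [k], as an offset from [k].  At a stage
   [k], [f k] lets us decide [P k] inside the modality: if [P k] holds we are
   done, and otherwise the point locating the first witness from [k + 1] is a
   predecessor of ν, so the induction hypothesis applies.  The hypothesis
   [¬¬ ○ (Σ n, P n)] gives, since [False] is null, that a least witness exists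
   ¬¬-ly, which is exactly what makes the starting point (from [k = 0]) an
   element of ∇₀ℕ. *)
Require Import Defs.
From Stdlib Require Import Arith Lia.

Lemma triple_neg_elim (Q : Prop) : ~ ~ ~ Q -> ~ Q.
Proof. tauto. Qed.

Definition nn_prop (Q : Prop) : OmegaNN := exist _ (~ ~ Q) (triple_neg_elim (~ Q)).

Definition nabla0_of {X : Type} (Q : X -> Prop) (ex : ~ ~ exists x, Q x)
  (uniq : forall x y, Q x -> Q y -> x = y) : nabla0 X.
Proof.
  refine (existT _ (fun x => nn_prop (Q x)) (_, _)).
  - intro no; apply ex; intros [x q]; exact (no (existT _ x (fun nq => nq q))).
  - intros x y nnqx nnqy neq.
    apply nnqx; intro qx; apply nnqy; intro qy; exact (neq (uniq x y qx qy)).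
Defined.

Lemma nabla0_nonempty {X : Type} (nu : nabla0 X) : ~ ~ exists x, downEq nu x.
Proof.
  intro no; apply (fst (projT2 nu)); intros [x hx]; exact (no (ex_intro _ x hx)).
Qed.

Lemma isNull_False {A : Type} (B : A -> Type) :
  (forall a, (B a -> False) -> False) -> isNull B False.
Proof.
  intros nnB a; split.
  - exists (fun h => match nnB a h with end); intro h; destruct (nnB a h).
  - exists (fun h => match nnB a h with end); intros [].
Qed.

Section OracleModality.
Variables (A B : Type) (chi : A -> nabla0 B) (O : OracleModality chi).

Lemma nO_False_null : isNull (fun a => down (chi a)) False.
Proof. apply isNull_False; intro a; exact (fst (projT2 (chi a))). Qed.

Definition nBind {X Y : Type} (g : X -> nO O Y) (z : nO O X) : nO O Y :=
  nInd _ O X (fun _ => nO O Y) (fun _ => nO_null _ O Y) g z.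

Lemma nO_nn_inhabited (X : Type) : nO O X -> ~ ~ inhabited X.
Proof.
  intros z nX.
  exact (nInd _ O X (fun _ => False) (fun _ => nO_False_null)
           (fun x => nX (inhabits x)) z).
Qed.

End OracleModality.

Lemma nn_excluded_middle (Q G : Prop) : ((Q \/ ~ Q) -> ~ ~ G) -> ~ ~ G.
Proof. tauto. Qed.

Section FirstWitness.
Variable P : nat -> Type.

Definition first_from (k m : nat) : Prop :=
  inhabited (P (k + m)) /\ forall j, j < m -> ~ inhabited (P (k + j)).

Lemma first_from_unique k m m' : first_from k m -> first_from k m' -> m = m'.
Proof.
  intros [Pm Hm] [Pm' Hm'].
  destruct (lt_eq_lt_dec m m') as [[lt|eq]|lt].
  - destruct (Hm' m lt Pm).
  - exact eq.
  - destruct (Hm m' lt Pm').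
Qed.

Lemma first_from_succ k m : ~ inhabited (P k) ->
  first_from (S k) m <-> first_from k (S m).
Proof.
  intro nPk; unfold first_from; cbn.
  rewrite <- plus_n_Sm; split; intros [Pm Hm]; split; try exact Pm.
  - intros [|j] lj; [rewrite Nat.add_0_r; exact nPk|].
    rewrite <- plus_n_Sm; apply Hm; lia.
  - intros j lj; rewrite plus_n_Sm; apply Hm; lia.
Qed.

Lemma first_from_zero_offset k : first_from k 0 -> inhabited (P k).
Proof. rewrite <- (Nat.add_0_r k) at 2; intros [Pk _]; exact Pk. Qed.

Lemma nn_first_from_succ k : ~ inhabited (P k) ->
  ~ ~ (exists m, first_from k m) -> ~ ~ exists m, first_from (S k) m.
Proof.
  intros nPk ex no; apply ex; intros [[|m] hm].
  - exact (nPk (first_from_zero_offset k hm)).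
  - apply no; exists m; apply first_from_succ; assumption.
Qed.

Lemma nn_least_witness n : inhabited (P n) -> ~ ~ exists m, first_from 0 m.
Proof.
  induction n as [n IH] using lt_wf_ind; intro Pn.
  apply (nn_excluded_middle (exists j, j < n /\ inhabited (P j))).
  intros [[j [lj Pj]] | none].
  - exact (IH j lj Pj).
  - intro no; apply no; exists n; split; [exact Pn|].
    intros j lj Pj; apply none; exists j; split; assumption.
Qed.

Definition first_nabla k (ex : ~ ~ exists m, first_from k m) : nabla0 nat :=
  nabla0_of (first_from k) ex (first_from_unique k).

Definition locates (nu : nabla0 nat) (k : nat) : Prop :=
  forall m, downEq nu m <-> ~ ~ first_from k m.

Lemma locates_first_nabla k ex : locates (first_nabla k ex) k.
Proof. intro m; reflexivity. Qed.

Lemma locates_nonempty nu k : locates nu k -> ~ ~ exists m, first_from k m.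
Proof.
  intros loc no; apply (nabla0_nonempty nu); intros [m hm].
  apply (proj1 (loc m) hm); intro h; exact (no (ex_intro _ m h)).
Qed.

Lemma locates_IsSuc nu mu k : ~ inhabited (P k) ->
  locates nu k -> locates mu (S k) -> IsSuc mu nu.
Proof.
  intros nPk locnu locmu m hm; apply locnu.
  intro no; apply (proj1 (locmu m) hm); intro h.
  exact (no (proj1 (first_from_succ k m nPk) h)).
Qed.

End FirstWitness.

Section Search.
Variables (A B : Type) (chi : A -> nabla0 B) (O : OracleModality chi).
Variable P : nat -> Type.
Hypothesis decide_P : forall n, nO O (P n + (P n -> False))%type.

Definition search_from (nu : nabla0 nat) : Type :=
  forall k, locates P nu k -> nO O {n : nat & P n}.

Lemma search_from_step nu :
  (forall mu, IsSuc mu nu -> search_from mu) -> search_from nu.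
Proof.
  intros IH k loc.
  refine (nBind A B chi O _ (decide_P k)); intros [p | np].
  - exact (nEta O (existT _ k p)).
  - assert (nPk : ~ inhabited (P k)) by (intros [p]; exact (np p)).
    pose (mu := first_nabla P (S k)
                  (nn_first_from_succ P k nPk (locates_nonempty P nu k loc))).
    apply (IH mu (locates_IsSuc P nu mu k nPk loc (locates_first_nabla P _ _)) (S k)).
    apply locates_first_nabla.
Qed.

End Search.

Theorem mainTheorem10 (MI : MarkovInduction)
  (A B : Type) (chi : A -> nabla0 B) (O : OracleModality chi)
  (P : nat -> Type)
  (f : forall n : nat, nO O (P n + (P n -> False))%type) :
  ((nO O {n : nat & P n} -> False) -> False) -> nO O {n : nat & P n}.
Proof.
  intro nnSearch.
  assert (ex0 : ~ ~ exists m, first_from P 0 m).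
  { intro no; apply nnSearch; intro z.
    apply (nO_nn_inhabited A B chi O _ z); intros [[n p]].
    exact (nn_least_witness P n (inhabits p) no). }
  exact (MI (search_from A B chi O P) (search_from_step A B chi O P f)
            (first_nabla P 0 ex0) 0 (locates_first_nabla P 0 ex0)).
Qed.
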